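(* Let $\mathcal{C}$ be a uniform clutter (all edges of the same cardinality) on $n$ vertices whose incidence matrix has rank $n$, and let $I\subset R=K[y_1,\ldots,y_n]$ be its edge ideal. Assume $I$ is normal, and let $\mathbb{T}=\{[(x_1,\ldots,x_n)]\in\mathbb{P}^{n-1}: x_i\in K^*\}$ be the projective torus in $\mathbb{P}^{n-1}$. Then: (a) $\deg(S/I(X))=|X|=(q-1)^{n-1}$; (b) for every $d\geq 1$, $\delta_d\leq\delta_d'$, where $\delta_d$ is the minimum distance of $C_X(d)$ and $\delta_d'$ is the minimum distance of $C_{\mathbb{T}}(d)$; (c) $\mathrm{reg}(S/I(X))\leq \mathrm{reg}(S'/I(\mathbb{T}))=(q-2)(n-1)$, where $S'=K[t_1,\ldots,t_n]$.
   Context: Let $K=\mathbb{F}_q$ be a finite field with $q\neq 2$ elements. A clutter $\mathcal{C}$ with vertex set $\{y_1,\ldots,y_n\}$ is a family of subsets (edges) of this set such that no edge is contained in another; let its edges be $f_1,\ldots,f_s$ ($s\geq 2$) with characteristic vectors $v_i=\sum_{y_j\in f_i}e_j\in\{0,1\}^n$. The incidence matrix is the $n\times s$ matrix with columns $v_1,\ldots,v_s$. The edge ideal is $I=(y^{v_1},\ldots,y^{v_s})\subset R$; $I$ is normal if $I^i=\overline{I^i}$ for all $i\geq 1$, where $\overline{I^i}$ is the ideal generated by the monomials $y^a$ with $(y^a)^p\in I^{pi}$ for some integer $p\geq 1$. For a finite set $Y=\{[P_1],\ldots,[P_m]\}\subset\mathbb{P}^{r-1}$ whose points have all coordinates nonzero,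 with $S_Y=K[t_1,\ldots,t_r]$, let $I(Y)$ be the ideal generated by homogeneous polynomials vanishing on $Y$; the code $C_Y(d)$ is the image of the $K$-linear map $(S_Y)_d\to K^m$, $f\mapsto (f(P_1)/P_{1,1}^d,\ldots,f(P_m)/P_{m,1}^d)$; its minimum distance is $\min\{\|v\|:0\neq v\in C_Y(d)\}$, $\|v\|$ being the number of nonzero entries. $H_Y(d)=\dim_K(S_Y/I(Y))_d$; $\deg(S_Y/I(Y))$ is the multiplicity, which equals the constant value of $H_Y(d)$ for $d\gg0$; $\mathrm{reg}(S_Y/I(Y))$ is the least $p\geq 0$ with $H_Y(d)=|Y|$ for all $d\geq p$. Here $X=\{[(x^{v_1},\ldots,x^{v_s})]\in\mathbb{P}^{s-1}: x\in (K^* )^n\}$ with $x^{v_i}=\prod_j x_j^{v_{ij}}$, and $S=K[t_1,\ldots,t_s]$. *)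

(* Defs.v *)
From HB Require Import structures.
From mathcomp Require Import all_boot all_order all_algebra.
Set Implicit Arguments. Unset Strict Implicit. Unset Printing Implicit Defensive.
Import GRing.Theory.
Local Open Scope ring_scope.

Section Defs.
Variable K : finFieldType.

Definition is_clutter (n s : nat) (f : 'I_s -> {set 'I_n}) : Prop :=
  forall i j : 'I_s, i != j -> ~~ (f i \subset f j).

Definition is_uniform (n s : nat) (f : 'I_s -> {set 'I_n}) : Prop :=
  forall i j : 'I_s, #|f i| = #|f j|.

Definition incidence_mx (n s : nat) (f : 'I_s -> {set 'I_n}) : 'M[rat]_(n, s) :=
  \matrix_(k < n, i < s) ((k \in f i) : nat)%:R.

Definition charv (n s : nat) (f : 'I_s -> {set 'I_n}) (i : 'I_s) (k : 'I_n) : nat :=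
  (k \in f i).

(* the monomial y^a lies in I^i  <=>  it is divisible by a product of i generators *)
Definition mon_in_pow (n s : nat) (f : 'I_s -> {set 'I_n}) (i : nat) (a : 'I_n -> nat) : Prop :=
  exists js : i.-tuple 'I_s,
    forall k : 'I_n, (\sum_(j <- js) charv f j k <= a k)%N.

(* I normal: I^i = \bar{I^i} for all i >= 1 (both are monomial ideals, the
   inclusion I^i \subset \bar{I^i} being automatic) *)
Definition edge_ideal_normal (n s : nat) (f : 'I_s -> {set 'I_n}) : Prop :=
  forall i : nat, (0 < i)%N -> forall a : 'I_n -> nat,
    (exists p : nat, (0 < p)%N /\ mon_in_pow f (p * i) (fun k => p * a k)%N) ->
    mon_in_pow f i a.

(* the projective point [P] as the set of nonzero multiples of P *)
Definition pclass (r : nat) (P : 'rV[K]_r) : {set 'rV[K]_r} :=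
  [set c *: P | c in [set c : K | c != 0]].

Definition in_torus (r : nat) (x : 'rV[K]_r) : bool := [forall j, x 0 j != 0].

Definition proj_torus (r : nat) : {set {set 'rV[K]_r}} :=
  [set pclass x | x in [set x : 'rV[K]_r | in_torus x]].

Definition param_point (n s : nat) (f : 'I_s -> {set 'I_n}) (x : 'rV[K]_n) : 'rV[K]_s :=
  \row_(i < s) \prod_(j in f i) x 0 j.

Definition param_set (n s : nat) (f : 'I_s -> {set 'I_n}) : {set {set 'rV[K]_s}} :=
  [set pclass (param_point f x) | x in [set x : 'rV[K]_n | in_torus x]].

(* monomials of degree d in r variables (exponent vectors) ; they form a
   basis of (S)_d, S = K[t_1..t_r] *)
Definition mons (r d : nat) : {set {ffun 'I_r -> 'I_d.+1}} :=
  [set a : {ffun 'I_r -> 'I_d.+1} | (\sum_(i < r) (a i : nat) == d)%N].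

Definition mon_eval (r d : nat) (a : {ffun 'I_r -> 'I_d.+1}) (P : 'rV[K]_r) : K :=
  \prod_(i < r) P 0 i ^+ a i.

Definition rep (r : nat) (p : {set 'rV[K]_r}) : 'rV[K]_r := odflt 0 [pick x in p].

(* first coordinate P_{1} (0 if r = 0) *)
Definition fcoord (r : nat) (P : 'rV[K]_r) : K := head 0 [seq P 0 i | i <- enum 'I_r].

(* evaluation matrix of the degree-d monomials at the points of Y (rows:
   monomials, columns: points); a degree-d form with coefficient row vector c
   vanishes on Y iff c *m eval_mx Y d = 0 *)
Definition eval_mx (r : nat) (Y : {set {set 'rV[K]_r}}) (d : nat)
  : 'M[K]_(#|mons r d|, #|Y|) :=
  \matrix_(i < #|mons r d|, j < #|Y|) mon_eval (enum_val i) (rep (enum_val j)).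

(* generator matrix of C_Y(d): row i = (f(P_1)/P_{1,1}^d, ..., f(P_m)/P_{m,1}^d)
   for f the i-th monomial of degree d *)
Definition code_mx (r : nat) (Y : {set {set 'rV[K]_r}}) (d : nat)
  : 'M[K]_(#|mons r d|, #|Y|) :=
  \matrix_(i < #|mons r d|, j < #|Y|)
     (mon_eval (enum_val i) (rep (enum_val j)) / fcoord (rep (enum_val j)) ^+ d).

Definition hweight (m : nat) (v : 'rV[K]_m) : nat := #|[set j | v 0 j != 0]|.

Definition min_dist (r : nat) (Y : {set {set 'rV[K]_r}}) (d : nat) : nat :=
  \big[minn/#|Y|]_(v : 'rV[K]_#|Y| | (v != 0) && (v <= code_mx Y d)%MS) hweight v.

(* H_Y(d) = dim (S)_d - dim I(Y)_d, with I(Y)_d the degree-d forms vanishing on Y *)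
Definition hilb (r : nat) (Y : {set {set 'rV[K]_r}}) (d : nat) : nat :=
  (#|mons r d| - \rank (kermx (eval_mx Y d)))%N.

Definition is_degree (r : nat) (Y : {set {set 'rV[K]_r}}) (m : nat) : Prop :=
  exists d0 : nat, forall d : nat, (d0 <= d)%N -> hilb Y d = m.

Definition is_reg (r : nat) (Y : {set {set 'rV[K]_r}}) (p : nat) : Prop :=
  (forall d : nat, (p <= d)%N -> hilb Y d = #|Y|) /\
  (forall p' : nat, (forall d : nat, (p' <= d)%N -> hilb Y d = #|Y|) -> (p <= p')%N).

End Defs.

(* Main.v *)
(** Write Q = q - 1 and N = n - 1. Uniformity and rank n put e_a - e_b into the
    rational span of the edge vectors; normality then turns
    M (v_1 + ... + v_s) + e_a - e_b, for M large, into a sum of edge vectors.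
    Hence x^{v_1} = ... = x^{v_s} forces x to be constant, and X, like the
    torus T, is in bijection with the points x of the torus with x_1 = 1.

    Lower bound for T: by the Alon-Furedi theorem a nonzero codeword of degree d
    has weight at least a product of integers y_j in [1, Q] with
    N (Q - 1) <= sum (y_j - 1) + d.

    Upper bound for X: the ratios t_i / t_1 are characters on X, so their fibres
    have equal size. Killing their values one linear factor at a time, one
    character after the other, gives a codeword of degree d whose weight w is 1
    or satisfies w * prod e_i <= Q^N * r with e_i, r in [1, Q] and
    d + r - 1 <= sum (e_i - 1).

    The two are compared by a single inequality: integers in [1, Q] whose
    decrements sum to at least N (Q - 1) + r - 1 have product at least Q^N * r.
    Applied to the y_j and e_i together it gives (b); applied to the e_i alone it
    shows that points of X are separated in degree N (Q - 1). *)

Require Import Defs.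
From HB Require Import structures.
From mathcomp Require Import all_boot all_order all_algebra.
From mathcomp Require Import zify ring.
Set Implicit Arguments. Unset Strict Implicit. Unset Printing Implicit Defensive.
Import Order.TTheory GRing.Theory Num.Theory.
Local Open Scope ring_scope.

(** * Nonzeros of polynomials on a grid *)

Definition between (Q : nat) : pred nat := fun e => (1 <= e <= Q)%N.

(** Concavity: at a fixed sum, a product is least when its factors are pushed to the ends of
    [[1, Q]]. Each new entry [e] is merged with [r], which serves as the single factor not yet at an
    end. *)
Lemma prod_ge_of_sum (Q N r : nat) (es : seq nat) :
  between Q r -> all (between Q) es ->
  (N * (Q - 1) + r <= 1 + \sum_(e <- es) (e - 1))%N ->
  (Q ^ N * r <= \prod_(e <- es) e)%N.
Proof.
elim: es N r => [|e es IH] N r /= br; rewrite ?big_nil ?big_cons.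
  move=> _; move: br; rewrite /between; case: N => [|N]; first by lia.
  rewrite mulSn; case: (Q) => [|[|Q']]; [lia| |lia].
  by rewrite exp1n; lia.
case/andP=> be bes hs.
(* For [e <= r], the new remainder is [r - e + 1], and [e * (r - e + 1) - r = (e - 1) * (r - e)] is
   nonnegative. *)
case: (leqP e r) => her.
  have := IH N (r - e + 1)%N _ bes _.
  move: br be hs; rewrite /between; set S := (\sum_(_ <- _) _)%N.
  set P := (\prod_(_ <- _) _)%N; set M := (N * _)%N; set X := (Q ^ N)%N.
  move=> br be hs /(_ _ _) h.
  have {}h : (X * (r - e + 1) <= P)%N by apply: h; lia.
  have : (X * r <= X * (e * (r - e + 1)))%N by rewrite leq_mul2l; apply/orP; right; nia.
  move=> h1; apply: leq_trans h1 _.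
  by rewrite mulnCA leq_mul2l h orbT.
case: N hs => [|N] hs.
  rewrite expn0 mul1n; apply: leq_trans (ltnW her) _.
  rewrite -[leqLHS]muln1 leq_mul2l; apply/orP; right.
  rewrite big_seq_cond; apply: prodn_cond_gt0 => i; rewrite andbT => hi.
  by have /allP /(_ i hi) /andP [] := bes.
(* For [e > r], one full factor [Q] is traded for the remainder [Q + r - e]: [e * (Q + r - e) - Q *
   r = (e - r) * (Q - e)] is nonnegative. *)
have {}IH := IH N (Q + r - e)%N _ bes _.
move: br be hs IH; rewrite /between mulSn expnS; set S := (\sum_(_ <- _) _)%N.
set P := (\prod_(_ <- _) _)%N; set M := (N * _)%N; set X := (Q ^ N)%N.
move=> br be hs h.
have {}h : (X * (Q + r - e) <= P)%N by apply: h; lia.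
have : (X * (Q * r) <= X * (e * (Q + r - e)))%N.
  by rewrite leq_mul2l; apply/orP; right; nia.
rewrite mulnA (mulnC X Q) => h1; apply: leq_trans h1 _.
by rewrite mulnCA leq_mul2l h orbT.
Qed.

(** * The Alon-Furedi theorem on the grid of nonzero scalars *)

Section AlonFuredi.
Variable K : finFieldType.
Implicit Types (F G : seq K -> K) (x : seq K) (c : K) (N d : nat).

(** Polynomial functions of total degree at most [d], presented by their coefficients in the first
    variable so that induction on [N] applies. Only lists of length [N] matter, so at [N = 0] every
    function is a constant. *)
Fixpoint polyfun N d F : Prop :=
  if N is N'.+1 then
    exists2 g : nat -> seq K -> K,
      (forall j, (j <= d)%N -> polyfun N' (d - j) (g j)) &
      (forall c x, size x = N' -> F (c :: x) = \sum_(j < d.+1) c ^+ j * g j x)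
  else True.

Definition in_grid N x := (size x == N) && all (fun c => c != 0) x.

Fixpoint grid_weight N F : nat :=
  if N is N'.+1 then
    (\sum_(c : K | c != 0%R) grid_weight N' (fun x => F (c :: x)))%N
  else (F [::] != 0 : bool).

Lemma eq_grid_weight_nz N F G :
  (forall x, in_grid N x -> (F x == 0) = (G x == 0)) -> grid_weight N F = grid_weight N G.
Proof.
elim: N F G => [|N IH] F G h /=; first by rewrite h.
apply: eq_bigr => c c0; apply: IH => x /andP [/eqP sx nx]; apply: h.
by rewrite /in_grid /= sx eqxx c0.
Qed.

Lemma eq_polyfun N d F G :
  (forall x, size x = N -> F x = G x) -> polyfun N d F -> polyfun N d G.
Proof.
case: N => [//|N] h [g hg hF]; exists g => // c x sx.
by rewrite -h /= ?sx // hF.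
Qed.

Lemma polyfun0 N d : polyfun N d (fun=> 0).
Proof.
elim: N d => [//|N IH] d /=; exists (fun _ _ => 0) => // c x _.
by rewrite big1 // => i _; rewrite mulr0.
Qed.

Lemma polyfunW N d d' F : (d <= d')%N -> polyfun N d F -> polyfun N d' F.
Proof.
elim: N d d' F => [//|N IH] d d' F hd [g hg hF].
exists (fun j => if (j <= d)%N then g j else fun=> 0).
  move=> j hj; case: leqP => hjd; first by apply: IH (hg j hjd); lia.
  exact: polyfun0.
move=> c x sx; rewrite hF //.
rewrite (big_ord_widen d'.+1 (fun j => c ^+ j * g j x)) //.
rewrite big_mkcond /=; apply: eq_bigr => j _.
by rewrite ltnS; case: leqP => //; rewrite mulr0.
Qed.

Lemma polyfunD N d F G :
  polyfun N d F -> polyfun N d G -> polyfun N d (fun x => F x + G x).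
Proof.
elim: N d F G => [//|N IH] d F G [g hg hF] [g' hg' hG].
exists (fun j x => g j x + g' j x) => [j hj|c x sx].
  by apply: IH; [apply: hg|apply: hg'].
by rewrite hF // hG // -big_split; apply: eq_bigr => j _; rewrite mulrDr.
Qed.

Lemma polyfunZ N d a F : polyfun N d F -> polyfun N d (fun x => a * F x).
Proof.
elim: N d F => [//|N IH] d F [g hg hF].
exists (fun j x => a * g j x) => [j hj|c x sx]; first by apply: IH; apply: hg.
by rewrite hF // big_distrr; apply: eq_bigr => j _; rewrite mulrCA.
Qed.

Lemma polyfun_sum (I : Type) (r : seq I) (P : pred I) N d (H : I -> seq K -> K) :
  (forall i, P i -> polyfun N d (H i)) ->
  polyfun N d (fun x => \sum_(i <- r | P i) H i x).
Proof.
move=> h; elim: r => [|i r IH].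
  by apply: eq_polyfun (polyfun0 N d) => x _; rewrite big_nil.
apply: (@eq_polyfun _ _ (fun x => (if P i then H i x else 0)
   + \sum_(j <- r | P j) H j x)).
  by move=> x _; rewrite big_cons; case: ifP => _ //; rewrite add0r.
apply: polyfunD => //; case hi: (P i); first exact: h.
exact: polyfun0.
Qed.

Lemma polyfun_monomial (a : nat -> nat) N d :
  (\sum_(i < N) a i <= d)%N ->
  polyfun N d (fun x => \prod_(i < N) nth 0 x i ^+ a i).
Proof.
elim: N a d => [//|N IH] a d; rewrite big_ord_recl /= => hd.
exists (fun j x => if j == a 0%N then \prod_(i < N) nth 0 x i ^+ a i.+1 else 0).
  move=> j hj; case: eqP => [->|_]; last exact: polyfun0.
  by apply: (IH (fun i => a i.+1)); rewrite leq_subRL //; lia.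
move=> c x sx; rewrite big_ord_recl /=.
have ha : (a 0%N < d.+1)%N by lia.
rewrite (bigD1 (Ordinal ha)) //= eqxx [X in _ + X]big1 ?addr0 // => i hi.
by case: eqP => [e|_]; [case/eqP: hi; apply: val_inj|rewrite mulr0].
Qed.

Lemma polyfun_cons N d F c : polyfun N.+1 d F -> polyfun N d (fun x => F (c :: x)).
Proof.
case=> g hg hF.
apply: (@eq_polyfun _ _ (fun x => \sum_(j < d.+1) c ^+ j * g j x)).
  by move=> x sx; rewrite hF.
apply: polyfun_sum => j _; apply: polyfunZ.
by apply: polyfunW (hg j _); [exact: leq_subr|rewrite -ltnS].
Qed.

(* Synthetic division by [X - c], coefficientwise in the remaining variables. *)
Lemma polyfun_factor N d F c :
  polyfun N.+1 d.+1 F -> (forall x, in_grid N x -> F (c :: x) = 0) ->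
  exists2 G, polyfun N.+1 d G &
    forall b x, in_grid N x -> F (b :: x) = (b - c) * G (b :: x).
Proof.
case=> g hg hF h0.
(* The coefficient of [X^j] in the sum over [i] of [g i x * (X^i - c^i) / (X - c)]. *)
pose g' j x := \sum_(i < d.+2 | (j < i)%N) c ^+ (i - j.+1) * g i x.
exists (fun y => if y is b :: x then \sum_(j < d.+1) b ^+ j * g' j x else 0).
  exists g' => // j hj; apply: polyfun_sum => i hi; apply: polyfunZ.
  by apply: polyfunW (hg i _); [lia|rewrite -ltnS].
move=> b x gx; have sx : size x = N by case/andP: gx => /eqP.
(* Subtracting the vanishing value at [c] turns each [b^i] into [b^i - c^i], which has the factor
   [b - c]. *)
rewrite -[LHS]subr0 -[X in _ - X](h0 x gx) !hF // -sumrB.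
transitivity (\sum_(i < d.+2) (b - c) *
   (\sum_(j < d.+1 | (j < i)%N) b ^+ j * c ^+ (i - j.+1)) * g i x).
  apply: eq_bigr => i _; rewrite -mulrBl; congr (_ * _).
  rewrite -opprB subrXX -mulNr opprB; congr (_ * _).
  rewrite (big_ord_widen d.+1 (fun j => c ^+ (i.-1 - j) * b ^+ j)) -1?ltnS //.
  by apply: eq_bigr => j hj; rewrite mulrC; congr (_ * c ^+ _); lia.
under eq_bigr do rewrite -mulrA.
rewrite -big_distrr; congr (_ * _).
under eq_bigr do rewrite big_distrl.
rewrite (exchange_big_dep predT) //=. apply: eq_bigr => j _.
rewrite /g' big_distrr /=. by apply: eq_bigr => i _; rewrite /= mulrA.
Qed.

Definition units_card := #|[pred c : K | c != 0]|.

(** Induction on [d], with an arbitrary set [A] of values for the first variable. If the slice at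
    some [c] in [A] vanishes, dividing by [X - c] lowers both [d] and the size of [A] by one; if
    none does, every slice obeys the bound in [N] variables and [r] is the size of [A]. *)
Lemma alon_furedi_step N :
  (forall d F, polyfun N d F -> (exists2 x, in_grid N x & F x != 0) ->
    exists2 ys : seq nat, all (between units_card) ys &
      (N * (units_card - 1) <= \sum_(y <- ys) (y - 1) + d)%N /\
      (\prod_(y <- ys) y <= grid_weight N F)%N) ->
  forall d F (A : {set K}), polyfun N.+1 d F ->
    (exists2 c, c \in A & exists2 x, in_grid N x & F (c :: x) != 0) ->
    exists r, exists2 ys : seq nat, all (between units_card) ys &
      [/\ (1 <= r <= #|A|)%N,
          (#|A| + N * (units_card - 1) <= r + \sum_(y <- ys) (y - 1) + d)%N &
          (r * \prod_(y <- ys) y <=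
             \sum_(c in A) grid_weight N (fun x => F (c :: x)))%N].
Proof.
move=> IH.
have nzcase d F (A : {set K}) : polyfun N.+1 d F -> A != set0 ->
    (forall c, c \in A -> exists2 x, in_grid N x & F (c :: x) != 0) ->
    exists r, exists2 ys : seq nat, all (between units_card) ys &
      [/\ (1 <= r <= #|A|)%N,
          (#|A| + N * (units_card - 1) <= r + \sum_(y <- ys) (y - 1) + d)%N &
          (r * \prod_(y <- ys) y <=
             \sum_(c in A) grid_weight N (fun x => F (c :: x)))%N].
  move=> pF /set0Pn [c0 c0A] nz.
  pose w c := grid_weight N (fun x => F (c :: x)).
  (* The slice of least weight supplies one list [ys] that is valid for all slices. *)
  have [c cA cmin] := @arg_minnP _ c0 (mem A) w c0A.
  have [ys bys [hs hp]] := IH d _ (polyfun_cons c pF) (nz c cA).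
  exists #|A|; exists ys => //; split.
  - by rewrite leqnn andbT; apply/card_gt0P; exists c.
  - by rewrite -addnA leq_add2l.
  - rewrite -sum_nat_const; apply: leq_sum => b bA.
    exact: leq_trans hp (cmin b bA).
move=> d F A; elim: d F A => [|d IHd] F A pF [c0 c0A [x0 gx0 Fx0]].
all: have [/exists_inP [c cA /forallP c0P]|] := boolP [exists c in A,
       [forall x : N.-tuple K, in_grid N x ==> (F (c :: x) == 0)]].
all: rewrite ?negb_exists_in.
(* In degree 0 the first variable does not occur, so one vanishing slice would make all of them
   vanish. *)
- case: pF => g _ hF; have /andP [sx0 _] := gx0.
  have := c0P (Tuple sx0); rewrite gx0 hF ?(eqP sx0) // big_ord1 => /eqP h.
  by move: Fx0; rewrite hF ?(eqP sx0) // big_ord1 h eqxx.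
- move=> /forall_inP nz; apply: nzcase pF _ _; first by apply/set0Pn; exists c0.
  move=> c /nz; rewrite negb_forall => /existsP [x].
  by rewrite negb_imply => /andP [gx hx]; exists (x : seq K).
- have {}c0P x : in_grid N x -> F (c :: x) = 0.
    move=> gx; have /andP [sx _] := gx.
    by have := c0P (Tuple sx); rewrite gx => /eqP.
  have [G pG hG] := polyfun_factor pF c0P.
  have c0c : c0 != c by apply: contraNneq Fx0 => ->; rewrite c0P.
  have [|r [ys bys [/andP [r1 rA] hs hp]]] := IHd G (A :\ c) pG.
    exists c0; first by rewrite !inE c0c.
    exists x0 => //; apply: contraNneq Fx0; rewrite hG // => ->.
    by rewrite mulr0.
  exists r; exists ys => //; move: (cardsD1 c A) rA hs; rewrite cA /=.
  move=> -> rA hs; split; [lia|lia|].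
  rewrite (bigD1 c) //=; apply: leq_trans hp _; apply: leq_trans (leq_addl _ _).
  rewrite [leqLHS](eq_bigl (fun i => (i \in A) && (i != c))); last first.
    by move=> i; rewrite !inE andbC.
  apply: leq_sum => b /andP [_ bc]; apply: eq_leq; apply: eq_grid_weight_nz.
  by move=> x gx; rewrite hG // mulf_eq0 subr_eq0 (negPf bc).
- move=> /forall_inP nz; apply: nzcase pF _ _; first by apply/set0Pn; exists c0.
  move=> c /nz; rewrite negb_forall => /existsP [x].
  by rewrite negb_imply => /andP [gx hx]; exists (x : seq K).
Qed.

(** In place of the minimum of the product over all admissible lists, one admissible list is
    produced; each variable contributes one entry. *)
Theorem alon_furedi N d F :
  polyfun N d F -> (exists2 x, in_grid N x & F x != 0) ->
  exists2 ys : seq nat, all (between units_card) ys &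
    (N * (units_card - 1) <= \sum_(y <- ys) (y - 1) + d)%N /\
    (\prod_(y <- ys) y <= grid_weight N F)%N.
Proof.
elim: N d F => [|N IH] d F pF [x gx Fx].
  exists [::] => //; rewrite big_nil mul0n; split=> //=.
  by move: gx Fx => /andP [/eqP /size0nil -> _] ->; rewrite big_nil.
case: x gx Fx => [//|c x] /andP [sx /= /andP [c0 nx]] Fx.
have [|r [ys bys [hr hs hp]]] := alon_furedi_step IH (A := [set c | c != 0]) pF.
  exists c; first by rewrite inE.
  by exists x => //; rewrite /in_grid -eqSS sx.
have cA : #|[set c : K | c != 0]| = units_card.
  by rewrite cardsE; apply: eq_card => b; rewrite !inE.
rewrite cA in hr hs; exists (r :: ys); first by rewrite /= /between hr.
rewrite !big_cons; split; first by rewrite mulSn; lia.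
apply: leq_trans hp _; apply: eq_leq; apply: eq_bigl => b; by rewrite inE.
Qed.

Lemma grid_weightE N F :
  grid_weight N F = #|[set x : N.-tuple K | in_grid N x && (F x != 0)]|.
Proof.
elim: N F => [|N IH] F /=.
  case: (boolP (F [::] == 0)) => h /=; apply/esym.
    by apply/eqP; rewrite cards_eq0; apply/eqP/setP=> x; rewrite !inE tuple0 /= h ?andbF.
  by rewrite (_ : [set _ | _] = [set [tuple]]) ?cards1 //; apply/setP=> x;
     rewrite !inE tuple0 /= h eqxx.
under eq_bigr do rewrite IH -sum1_card.
rewrite -sum1_card pair_big_dep /=.
rewrite [RHS](reindex (fun p : K * N.-tuple K => [tuple of p.1 :: p.2])) /=.
  by apply: eq_bigl => -[c x]; rewrite !inE /in_grid /= eqSS; case: (c != 0); rewrite ?andbF.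
exists (fun x : N.+1.-tuple K => (thead x, [tuple of behead x])) => [[c x] _|x _] /=.
  by congr pair; apply: val_inj.
by case/tupleP: x => c x; apply: val_inj.
Qed.

Lemma card_grid N : #|[set x : N.-tuple K | in_grid N x]| = (units_card ^ N)%N.
Proof.
have <- : grid_weight N (fun=> 1) = (units_card ^ N)%N.
  elim: N => [|N IH] /=; first by rewrite oner_eq0.
  by rewrite IH sum_nat_const expnS; congr muln; apply: eq_card.
by rewrite grid_weightE; apply: eq_card => x; rewrite !inE oner_neq0 andbT.
Qed.
End AlonFuredi.

(** * Products of linear factors in characters *)

Section Greedy.
Variables (K : finFieldType) (Y : finType) (I : eqType) (phi : I -> Y -> K).
(** [cl d] abstracts the functions given by forms of degree [d]. The constant 1 belongs to every
    degree because forms can be padded by powers of the first coordinate, which is normalized to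
    1. *)
Variable cl : nat -> (Y -> K) -> Prop.
Hypothesis cl1 : forall d, cl d (fun=> 1).
Hypothesis clM : forall i d v G, cl d G -> cl d.+1 (fun y => (phi i y - v) * G y).
Implicit Types (A : {set Y}) (l : seq I) (G : Y -> K) (p : Y).

Definition nonvanishing A := forall i y, y \in A -> phi i y != 0.

(** Models a torus acting on itself by translations, under which every character is multiplied by a
    constant. *)
Definition homogeneous A : Prop :=
  forall p p', p \in A -> p' \in A ->
  exists tau : Y -> Y, [/\ {in A &, injective tau}, tau p = p',
    forall y, y \in A -> tau y \in A &
    forall i, exists c, forall y, y \in A -> phi i (tau y) = c * phi i y].

Definition fiber A i p := [set y in A | phi i y == phi i p].

Lemma nonvanishing_fiber A i p : nonvanishing A -> nonvanishing (fiber A i p).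
Proof. by move=> nz j y; rewrite inE => /andP [yA _]; apply: nz. Qed.

(** A translation between two points of one fibre scales [phi i] by 1, since [phi i] has the same
    nonzero value at both; it therefore preserves the fibre. *)
Lemma homogeneous_fiber A i p :
  nonvanishing A -> homogeneous A -> homogeneous (fiber A i p).
Proof.
move=> nz hA x x'; rewrite !inE => /andP [xA /eqP xp] /andP [xA' /eqP xp'].
have [tau [ti tx tA tc]] := hA x x' xA xA'; have [c hc] := tc i.
have c1 : c = 1.
  have := hc x xA; rewrite tx xp' -xp -{1}[phi i x]mul1r.
  by move/(mulIf (nz i x xA)).
exists tau; split=> //.
- by move=> y y'; rewrite !inE => /andP [yA _] /andP [yA' _]; apply: ti.
- by move=> y; rewrite !inE => /andP [yA /eqP e]; rewrite tA // hc // c1 mul1r e eqxx.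
move=> j; have [b hb] := tc j; exists b => y.
by rewrite inE => /andP [yA _]; apply: hb.
Qed.

(** The translation from [p] to [p'] embeds one fibre in the other; exchanging the points yields
    equality. *)
Lemma card_fiber_le A i p p' : homogeneous A ->
  p \in A -> p' \in A -> (#|fiber A i p| <= #|fiber A i p'|)%N.
Proof.
move=> hA pA pA'; have [tau [ti tx tA tc]] := hA p p' pA pA'.
have [c hc] := tc i.
have sub : tau @: fiber A i p \subset fiber A i p'.
  apply/subsetP=> _ /imsetP [y + ->]; rewrite !inE => /andP [yA /eqP e].
  by rewrite tA // hc // e -hc // tx eqxx.
rewrite -(card_in_imset (f := tau)) ?subset_leq_card // => y y'.
by rewrite !inE => /andP [yA _] /andP [yA' _]; apply: ti.
Qed.

Lemma card_preim_fibers A i p (V : {set K}) : homogeneous A ->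
  p \in A -> V \subset phi i @: A ->
  #|[set y in A | phi i y \in V]| = (#|V| * #|fiber A i p|)%N.
Proof.
move=> hA pA sV.
rewrite -sum1_card (partition_big (phi i) (fun v => v \in V)) => [|y]; last first.
  by rewrite inE => /andP [].
rewrite -sum_nat_const; apply: eq_bigr => v vV.
have /imsetP [p' pA' vE] := subsetP sV v vV.
rewrite sum1dep_card (_ : [set _ | _] = fiber A i p').
  by apply/eqP; rewrite eqn_leq; apply/andP; split; apply: card_fiber_le hA _ _.
apply/setP=> y; rewrite !inE vE.
by case: eqP => [->|_]; rewrite ?andbF // -vE vV !andbT.
Qed.

Definition subtract_values i (vs : seq K) G y :=
  foldr (fun v z => (phi i y - v) * z) (G y) vs.

Lemma cl_subtract i vs d G : cl d G -> cl (size vs + d) (subtract_values i vs G).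
Proof. by move=> cG; elim: vs => [|v vs IHv] //=; apply: clM. Qed.

Lemma subtract_values_neq0 i vs G y :
  (subtract_values i vs G y != 0) = (phi i y \notin vs) && (G y != 0).
Proof.
rewrite /subtract_values; elim: vs => //= v vs IH.
by rewrite mulf_eq0 negb_or IH inE negb_or subr_eq0 andbA.
Qed.

(* By homogeneity all fibres of [phi i] on [A] have the same size, so killing
   all but one of its [e] values costs [e - 1] linear factors and divides the
   support by exactly [e]. *)
Lemma greedy_product l A p d :
  p \in A -> nonvanishing A -> homogeneous A ->
  (forall y, y \in A -> (forall i, i \in l -> phi i y = phi i p) -> y = p) ->
  exists2 G, cl d G & G p != 0 /\
  let w := #|[set y in A | G y != 0]| in
  w = 1%N \/
  exists es, exists2 r, between (units_card K) r & [/\ all (between (units_card K)) es,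
    (w * \prod_(e <- es) e <= #|A| * r)%N & (d + r <= 1 + \sum_(e <- es) (e - 1))%N].
Proof.
elim: l A d => [|i l IH] A d pA nz hA sep.
  exists (fun=> 1) => //; rewrite oner_neq0; split=> //; left.
  (* With no character left, separation reduces [A] to the point [p]. *)
  rewrite (_ : [set _ in A | _] = [set p]) ?cards1 //.
  apply/setP=> y; rewrite !inE /= ?oner_neq0 andbT.
  by apply/idP/eqP=> [/sep -> //|->].
set V := phi i @: A; set h := #|fiber A i p|.
have pV : phi i p \in V by apply: imset_f.
have cA : #|A| = (#|V| * h)%N.
  rewrite /h -(card_preim_fibers hA pA (subxx V)); apply: eq_card => y.
  by rewrite inE; case: (boolP (y \in A)) => // yA; rewrite imset_f.
have V1 : (0 < #|V|)%N by apply/card_gt0P; exists (phi i p).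
have bV : between (units_card K) #|V|.
  rewrite /between V1 /=; apply: subset_leq_card; apply/subsetP=> _ /imsetP [y yA ->].
  by rewrite inE nz.
pose vs := enum (V :\ phi i p).
have svs : size vs = #|V|.-1 by rewrite -cardE (cardsD1 (phi i p) V) pV.
have pvs : phi i p \notin vs by rewrite mem_enum !inE eqxx.
(* If the degree suffices to kill all values other than [phi i p], the recursion continues inside
   the fibre of [p]. *)
case: (leqP (size vs) d) => hd.
  have [|||y|G cG [Gp hG]] := IH (fiber A i p) (d - size vs)%N.
  - by rewrite inE pA eqxx.
  - exact: nonvanishing_fiber.
  - exact: homogeneous_fiber.
  - rewrite inE => /andP [yA /eqP yp] hy; apply: sep => // j.
    by rewrite inE => /orP [/eqP ->|/hy].
  exists (subtract_values i vs G).
    by rewrite -[d](subnKC hd); apply: cl_subtract.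
  rewrite subtract_values_neq0 pvs Gp; split=> //=.
  have -> : [set y in A | subtract_values i vs G y != 0] =
            [set y in fiber A i p | G y != 0].
    apply/setP=> y; rewrite !inE subtract_values_neq0 mem_enum !inE.
    by case: (boolP (y \in A)) => //= yA; rewrite imset_f // andbT negbK.
  case: hG => [->|[es [r br [bes hp hs]]]]; [by left|right].
  exists (#|V| :: es); exists r => //; split; first by rewrite /= bV.
  - rewrite big_cons cA -/h -mulnA mulnCA leq_mul2l -/h.
    by rewrite hp orbT.
  - by rewrite big_cons; lia.
(* Otherwise only [d] values are killed: [r] is the number of surviving values, and both bounds are
   equalities. *)
exists (subtract_values i (take d vs) (fun=> 1)).
  have := cl_subtract i (take d vs) (cl1 0).
  by rewrite addn0 size_take hd.
rewrite subtract_values_neq0 oner_neq0 andbT; split.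
  by apply: contra pvs; apply: mem_take.
right; exists [:: #|V|]; exists (#|V| - d)%N.
  by move: bV hd; rewrite svs /between; case: (#|V|) => [|m] /=; lia.
rewrite !big_seq1 /= bV; split=> //; last first.
  move: hd V1; rewrite svs; clear; case: #|V| => [|m] /=; lia.
rewrite (_ : [set y in A | _] = [set y in A | phi i y \in V :\: [set v in take d vs]]).
  rewrite (card_preim_fibers hA pA); last by rewrite subsetDl.
  rewrite -/h cA cardsD (setIidPr _); last first.
    by apply/subsetP=> v; rewrite inE => /mem_take; rewrite mem_enum inE => /andP [].
  have -> : #|[set v in take d vs]| = d.
    rewrite cardsE; have /card_uniqP -> : uniq (take d vs).
      by apply: take_uniq; apply: enum_uniq.
    by rewrite size_take hd.
  by rewrite mulnC -mulnA (mulnC h).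
apply/setP=> y; rewrite !inE subtract_values_neq0 oner_neq0 andbT.
by case: (boolP (y \in A)) => //= yA; rewrite imset_f ?andbT.
Qed.
End Greedy.

(** * Consequences of normality *)

Lemma common_denominator (s : nat) (u : 'I_s -> rat) :
  exists2 p : nat, (0 < p)%N & exists c : 'I_s -> int, forall i, (c i)%:~R = p%:R * u i.
Proof.
exists (\prod_i `|denq (u i)|)%N.
  by apply: prodn_gt0 => i; rewrite absz_gt0 denq_neq0.
exists (fun i => numq (u i) * (\prod_(j | j != i) `|denq (u j)|)%N%:Z) => i.
rewrite [in RHS](bigD1 i) //= intrM numqE natrM mulrAC -mulrA mulrC; congr (_ * _).
by rewrite mulrC -{1}[denq (u i)]gez0_abs ?denq_ge0.
Qed.

Lemma sum_flatten_nseq (s : nat) (m F : 'I_s -> nat) :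
  (\sum_(j <- flatten [seq nseq (m i) i | i <- enum 'I_s]) F j = \sum_i m i * F i)%N.
Proof.
rewrite big_flatten /= big_map big_enum; apply: eq_bigr => i _.
by rewrite big_nseq iter_addn_0 mulnC.
Qed.

Lemma sum_charv (n s : nat) (f : 'I_s -> {set 'I_n}) i :
  (\sum_k charv f i k = #|f i|)%N.
Proof. by rewrite /charv -sum1_card [RHS]big_mkcond; apply: eq_bigr => k _; case: ifP. Qed.

Section Normal.
Variables (n s : nat) (f : 'I_s -> {set 'I_n}).
Hypotheses (unif : is_uniform f) (fne : forall i, (0 < #|f i|)%N).
Hypothesis rk : \rank (incidence_mx f) = n.
Hypothesis s0 : (0 < s)%N.

(** Rank [n] makes [e_a - e_b] a rational combination of the edge vectors. Denominators are cleared
    by [p], and [M] copies of every edge make the coefficients nonnegative; [e_b] stays on the left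
    to remain within natural numbers. *)
Lemma incidence_relation (a b : 'I_n) :
  exists p M (m : 'I_s -> nat), [/\ (0 < p)%N,
    (forall k, \sum_i m i * charv f i k + p * (k == b)
               = p * (M * \sum_i charv f i k + (k == a)))%N &
    (\sum_i m i = p * (M * s))%N].
Proof.
have fr : row_free (incidence_mx f) by rewrite /row_free rk.
pose w : 'cV[rat]_n := \col_k ((k == a)%:R - (k == b)%:R).
have [u hu] : exists u, incidence_mx f *m u = w.
  by exists (pinvmx (incidence_mx f) *m w); rewrite mulmxA mulmxVp // mul1mx.
have [p p0 [c hc]] := common_denominator (fun i => u i 0).
(* This [M] dominates every [c i], hence [p * M + c i] is nonnegative. *)
pose M := (\sum_i `|c i|)%N; pose m i := absz ((p * M)%N%:Z + c i).
have mE i : (m i)%:R = p%:R * (M%:R + u i 0) :> rat.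
  rewrite mulrDr -natrM -hc pmulrn gez0_abs ?intrD // -[X in X <= _]/(0%:Z).
  have : (`|c i| <= M)%N by rewrite /M (bigD1 i) //= leq_addr.
  have : (M <= p * M)%N by rewrite leq_pmull.
  lia.
have rel k : (\sum_i m i * charv f i k + p * (k == b)
               = p * (M * \sum_i charv f i k + (k == a)))%N.
  apply/eqP; rewrite -(eqr_nat rat) natrD natr_sum natrM [X in _ == X]natrM.
  rewrite natrD natrM natr_sum.
  have := congr1 (fun A : 'cV_n => A k 0) hu; rewrite !mxE => hk.
  under eq_bigr do rewrite natrM mE.
  have {}hk : \sum_i u i 0 * (charv f i k)%:R = (k == a)%:R - (k == b)%:R.
    rewrite -hk; apply: eq_bigr => i _. by rewrite mxE mulrC.
  under eq_bigr do rewrite -mulrA mulrDl.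
  by rewrite -mulr_sumr big_split /= -mulr_sumr hk; apply/eqP; ring.
exists p; exists M; exists m; split=> //.
(* Summing the relation over all coordinates and cancelling the common edge size gives the total of
   the [m i]. *)
pose i0 := Ordinal s0.
have : (\sum_k (\sum_i m i * charv f i k + p * (k == b))
        = \sum_k p * (M * \sum_i charv f i k + (k == a)))%N.
  by apply: eq_bigr => k _; apply: rel.
rewrite big_split /= exchange_big /= -!big_distrr /= big_split /= -big_distrr /=.
rewrite [X in (_ = _ * (_ * X + _))%N]exchange_big /=.
have one (x : 'I_n) : (\sum_k (k == x) = 1)%N.
  by rewrite (bigD1 x) //= eqxx big1 // => k /negPf ->.
rewrite !one; under eq_bigr do rewrite -big_distrr /= sum_charv (unif _ i0).
under [X in (_ = _ * (_ * X + _))%N]eq_bigr do rewrite sum_charv (unif _ i0).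
rewrite -big_distrl /= sum_nat_const card_ord.
move=> h; apply/eqP; rewrite -(eqn_pmul2r (fne i0)) -(eqn_add2r p); apply/eqP.
by move: h; rewrite mulnDr !muln1 -!mulnA.
Qed.

Hypothesis nrm : edge_ideal_normal f.

(* [M * sum_i v_i + e_a - e_b] lies in the cone of the [v_i] for [M] large; by
   normality it is a sum of [M * s] of them, with equality because degrees agree. *)
Lemma exchange_relation (a b : 'I_n) : a != b ->
  exists M, exists js : (M * s).-tuple 'I_s, forall k,
   (\sum_(j <- js) charv f j k + (k == b) = M * \sum_i charv f i k + (k == a))%N.
Proof.
move=> ab; have [p [M [m [p0 rel sm]]]] := incidence_relation a b.
(* Positivity at [b], forced by the relation itself, makes the truncated subtraction in [W]
   exact. *)
have M0 : (0 < M * \sum_i charv f i b)%N.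
  have := rel b; rewrite eqxx eq_sym (negPf ab) /= => h.
  case: posnP h => // ->; lia.
pose W k := (M * \sum_i charv f i k + (k == a) - (k == b))%N.
have WE k : (W k + (k == b) = M * \sum_i charv f i k + (k == a))%N.
  rewrite /W subnK //; case: eqP => // ->; move: M0; lia.
have Ms : (0 < M * s)%N by move: M0; rewrite !muln_gt0 s0 => /andP [-> _].
pose js := flatten [seq nseq (m i) i | i <- enum 'I_s].
have sjs : size js == (p * (M * s))%N.
  rewrite -sm -sum1_size /js sum_flatten_nseq.
  by apply/eqP/eq_bigr => i _; rewrite muln1.
(* The edges listed in [js] show that the [p]-th power of [y^W] lies in the power [p * (M * s)] of
   the edge ideal. *)
have [|ks hks] := nrm Ms (a := W).
  exists p; split=> //; exists (Tuple sjs) => k /=.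
  rewrite sum_flatten_nseq -(leq_add2r (p * (k == b))) rel -mulnDr WE //.
exists M; exists ks => k; rewrite -WE; congr (_ + _)%N.
pose i0 := Ordinal s0.
have one (x : 'I_n) : (\sum_k (k == x) = 1)%N.
  by rewrite (bigD1 x) //= eqxx big1 // => k' /negPf ->.
have tot : (\sum_k \sum_(j <- ks) charv f j k == \sum_k W k)%N.
  have : (\sum_k W k + 1 = \sum_k (M * \sum_i charv f i k + (k == a)))%N.
    by rewrite -(one b) -big_split; apply: eq_bigr => k' _; rewrite /= WE.
  rewrite -(eqn_add2r 1) => ->.
  rewrite big_split /= !one -big_distrr /= exchange_big.
  rewrite [X in (_ == _ * X + _)%N]exchange_big /=.
  under eq_bigr do rewrite sum_charv (unif _ i0).
  under [X in (_ == _ * X + _)%N]eq_bigr do rewrite sum_charv (unif _ i0).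
  rewrite sum_nat_const card_ord big_const_seq count_predT size_tuple iter_addn_0.
  by rewrite mulnC mulnA.
(* Membership only gives coordinatewise inequalities; equal totals turn them into equalities. *)
have [|_] := @leqif_sum _ predT (fun k => \sum_(j <- ks) charv f j k == W k)%N
   (fun k => \sum_(j <- ks) charv f j k)%N W; first by move=> k' _; split.
by rewrite tot => /esym /forallP /(_ k) /eqP.
Qed.

(** Evaluating both sides of the exchange relation at [z] gives [c^(M s) * z b = c^(M s) * z a], and
    [c] is nonzero. This is what makes the parametrization injective. *)
Lemma constant_of_normal (K : finFieldType) (z : 'I_n -> K) c :
  (forall k, z k != 0) -> (forall i, \prod_(k in f i) z k = c) ->
  forall a b, z a = z b.
Proof.
move=> z0 zc a b; have [->//|ab] := eqVneq a b.
have [M [js rel]] := exchange_relation ab.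
have ze i : \prod_k z k ^+ charv f i k = c.
  rewrite -(zc i) [RHS]big_mkcond /=; apply: eq_bigr => k _.
  by rewrite /charv; case: (k \in f i).
have zx x : \prod_k z k ^+ (k == x) = z x.
  by rewrite (bigD1 x) //= eqxx big1 ?mulr1 // => k /negPf ->.
have zs (r : seq 'I_s) : \prod_k z k ^+ (\sum_(j <- r) charv f j k) = c ^+ size r.
  elim: r => [|j r IH]; first by rewrite big1 // => k _; rewrite big_nil.
  under eq_bigr do rewrite big_cons exprD.
  by rewrite big_split /= ze IH exprS.
have c0 : c != 0.
  by rewrite -(zc (Ordinal s0)); apply/prodf_neq0 => k _; apply: z0.
have : \prod_k z k ^+ (\sum_(j <- js) charv f j k + (k == b)) =
       \prod_k z k ^+ (M * \sum_i charv f i k + (k == a)).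
  by apply: eq_bigr => k _; rewrite rel.
under eq_bigr do rewrite exprD.
under [RHS]eq_bigr do rewrite exprD mulnC exprM.
rewrite !big_split /= !zx zs size_tuple prodrXl.
rewrite zs /index_enum -enumT size_enum_ord -exprM mulnC => /mulfI -> //.
by rewrite expf_neq0.
Qed.
End Normal.

(** * Evaluation codes *)

Section Codes.
Variable K : finFieldType.

Lemma fcoordE r (P : 'rV[K]_r.+1) : fcoord P = P 0 ord0.
Proof. by rewrite /fcoord enum_ordSl. Qed.

Lemma rep_pclass r (P : 'rV[K]_r) : exists2 c, c != 0 & rep (pclass P) = c *: P.
Proof.
rewrite /rep; case: pickP => [x /imsetP [c]|/(_ P)].
  by rewrite inE => c0 ->; exists c.
move/negP; case; apply/imsetP; exists 1; last by rewrite scale1r.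
by rewrite inE oner_neq0.
Qed.

(** Scaling the first coordinate to 1 absorbs the denominators of the code: codewords become plain
    values of forms. *)
Definition normalized_rep r (p : {set 'rV[K]_r}) := (fcoord (rep p))^-1 *: rep p.

Lemma normalized_rep_pclass r (P : 'rV[K]_r.+1) : P 0 0 != 0 ->
  normalized_rep (pclass P) = (P 0 0)^-1 *: P.
Proof.
move=> P0; rewrite /normalized_rep; have [c c0 ->] := rep_pclass P.
by rewrite fcoordE mxE scalerA invfM mulrAC mulVf // mul1r.
Qed.

Lemma mon_evalZ r d (a : {ffun 'I_r -> 'I_d.+1}) c (P : 'rV[K]_r) :
  a \in mons r d -> mon_eval a (c *: P) = c ^+ d * mon_eval a P.
Proof.
rewrite inE => /eqP ad; rewrite /mon_eval -[in c ^+ d]ad.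
under eq_bigr do rewrite mxE exprMn.
by rewrite big_split /= prodrXr.
Qed.

Lemma code_mxE r (Y : {set {set 'rV[K]_r}}) d i j :
  code_mx Y d i j = mon_eval (enum_val i) (normalized_rep (enum_val j)).
Proof. by rewrite mxE mon_evalZ ?enum_valP // exprVn mulrC. Qed.

Definition is_form r d (F : 'rV[K]_r -> K) :=
  exists c : {ffun 'I_r -> 'I_d.+1} -> K,
    forall P, F P = \sum_(a in mons r d) c a * mon_eval a P.

Lemma eq_is_form r d (F G : 'rV[K]_r -> K) : F =1 G -> is_form d F -> is_form d G.
Proof. by move=> FG [c hc]; exists c => P; rewrite -FG. Qed.

Lemma is_formD r d (F G : 'rV[K]_r -> K) :
  is_form d F -> is_form d G -> is_form d (fun P => F P + G P).
Proof.
move=> [c hc] [c' hc']; exists (fun a => c a + c' a) => P.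
by rewrite hc hc' -big_split; apply: eq_bigr => a _; rewrite mulrDl.
Qed.

Lemma is_formZ r d b (F : 'rV[K]_r -> K) : is_form d F -> is_form d (fun P => b * F P).
Proof.
move=> [c hc]; exists (fun a => b * c a) => P.
by rewrite hc mulr_sumr; apply: eq_bigr => a _; rewrite mulrA.
Qed.

Lemma is_form_sum (I : Type) (t : seq I) (Q : pred I) r d (H : I -> 'rV[K]_r -> K) :
  (forall i, Q i -> is_form d (H i)) -> is_form d (fun P => \sum_(i <- t | Q i) H i P).
Proof.
move=> h; elim: t => [|i t IH].
  exists (fun=> 0) => P; rewrite big_nil big1 // => a _; exact: mul0r.
case hi: (Q i); last by apply: eq_is_form IH => P; rewrite big_cons hi.
by apply: eq_is_form (is_formD (h i hi) IH) => P; rewrite big_cons hi.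
Qed.

Lemma is_form_mon r d (a : {ffun 'I_r -> 'I_d.+1}) :
  a \in mons r d -> is_form d (mon_eval a).
Proof.
move=> am; exists (fun b => (b == a)%:R) => P.
rewrite (bigD1 a) //= eqxx mul1r big1 ?addr0 // => b /andP [_ /negPf ->].
by rewrite mul0r.
Qed.

Lemma is_form1 r : is_form 0 (fun _ : 'rV[K]_r => 1).
Proof.
apply: eq_is_form (@is_form_mon r 0 [ffun=> ord0] _) => [P|].
  by rewrite /mon_eval big1 // => i _; rewrite ffunE.
by rewrite inE big1 // => i _; rewrite ffunE.
Qed.

Lemma is_formX r d (i : 'I_r) F :
  is_form d F -> is_form d.+1 (fun P : 'rV[K]_r => P 0 i * F P).
Proof.
case=> c hc.
(* The exponent bound grows along with the degree, so [inord] never falls back to its default. *)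
pose sh (a : {ffun 'I_r -> 'I_d.+1}) : {ffun 'I_r -> 'I_d.+2} :=
  [ffun j => inord (a j + (j == i))].
have shE a j : sh a j = (a j + (j == i))%N :> nat.
  by rewrite ffunE inordK //; have := ltn_ord (a j); case: eqP; lia.
apply: (@eq_is_form _ _ (fun P => \sum_(a in mons r d) c a * mon_eval (sh a) P)).
  move=> P; rewrite hc mulr_sumr; apply: eq_bigr => a _; rewrite mulrCA; congr (_ * _).
  rewrite /mon_eval; under eq_bigr do rewrite shE exprD.
  rewrite big_split /= mulrC; congr (_ * _).
  by rewrite (bigD1 i) //= eqxx big1 ?mulr1 // => j /negPf ->.
apply: is_form_sum => a; rewrite inE => /eqP ad; apply: is_formZ; apply: is_form_mon.
rewrite inE; under eq_bigr do rewrite shE.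
rewrite big_split /= ad (bigD1 i) //= eqxx big1 ?addn0 ?addn1 //.
by move=> j /negPf ->.
Qed.

Lemma is_form_code r (Y : {set {set 'rV[K]_r}}) d F : is_form d F ->
  (\row_j F (normalized_rep (enum_val j)) <= code_mx Y d)%MS.
Proof.
case=> c hc; apply/submxP; exists (\row_i c (enum_val i)).
apply/rowP=> j; rewrite !mxE hc big_enum_val; apply: eq_bigr => i _.
by rewrite code_mxE !mxE.
Qed.

Lemma code_is_form r (Y : {set {set 'rV[K]_r}}) d v : (v <= code_mx Y d)%MS ->
  exists2 F, is_form d F & v = \row_j F (normalized_rep (enum_val j)).
Proof.
case/submxP=> u ->.
exists (fun P => \sum_(i < #|mons r d|) u 0 i * mon_eval (enum_val i) P).
  by apply: is_form_sum => i _; apply: is_formZ; apply/is_form_mon/enum_valP.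
by apply/rowP=> j; rewrite !mxE; apply: eq_bigr => i _; rewrite code_mxE.
Qed.

Lemma hweight_row (T : finType) (Y : {set T}) (H : T -> K) :
  hweight (\row_(j < #|Y|) H (enum_val j)) = #|[set p in Y | H p != 0]|.
Proof.
rewrite /hweight -(card_imset _ enum_val_inj); apply: eq_card => p.
rewrite inE; apply/imsetP/andP.
  by case=> j; rewrite inE mxE => Hj ->; split=> //; apply: enum_valP.
case=> pY Hp; exists (enum_rank_in pY p); last by rewrite enum_rankK_in.
by rewrite inE mxE enum_rankK_in.
Qed.

Lemma min_dist_le r (Y : {set {set 'rV[K]_r}}) d v :
  v != 0 -> (v <= code_mx Y d)%MS -> (min_dist Y d <= hweight v)%N.
Proof.
move=> v0 vC; rewrite /min_dist.
have : v \in index_enum 'rV[K]_#|Y| by rewrite mem_index_enum.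
elim: (index_enum _) => // u t IH; rewrite inE big_cons => /orP [/eqP <-|/IH h].
  by rewrite v0 vC geq_minl.
by case: ifP => // _; apply: leq_trans (geq_minr _ _) h.
Qed.

Lemma min_dist_le_card r (Y : {set {set 'rV[K]_r}}) d : (min_dist Y d <= #|Y|)%N.
Proof.
rewrite /min_dist; apply: (big_ind (fun m => m <= #|Y|)%N) => // [x y hx hy|v _].
  exact: leq_trans (geq_minl _ _) hx.
by rewrite /hweight -[leqRHS]card_ord; apply: max_card.
Qed.

(** The two matrices differ by an invertible diagonal factor, so the Hilbert function is the
    dimension of the code. *)
Lemma hilbE r (Y : {set {set 'rV[K]_r}}) d :
  (forall p, p \in Y -> fcoord (rep p) != 0) -> hilb Y d = \rank (code_mx Y d).
Proof.
move=> nz; rewrite /hilb mxrank_ker subKn ?rank_leq_row //.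
pose D : 'rV[K]_#|Y| := \row_j (fcoord (rep (enum_val j)) ^+ d)^-1.
have -> : code_mx Y d = eval_mx Y d *m diag_mx D.
  by apply/matrixP=> i j; rewrite mul_mx_diag !mxE.
rewrite mxrankMfree // row_free_unit unitmxE det_diag unitfE.
apply/prodf_neq0 => j _; rewrite mxE invr_eq0 expf_neq0 //.
by apply: nz; apply: enum_valP.
Qed.

End Codes.

(** * Parameterized sets *)

Section AffineTorus.
Variables (K : finFieldType) (N : nat).

(** Normalized representatives of the points of the projective torus; here [n = N.+1]. *)
Definition affine_torus := [set x : 'rV[K]_N.+1 | in_torus x && (x 0 0 == 1)].

Definition homogenize (x : seq K) : 'rV[K]_N.+1 := \row_i nth 0 (1 :: x) i.

Lemma affine_torusE :
  affine_torus = [set homogenize (tval x) | x in [set x : N.-tuple K | in_grid N x]].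
Proof.
apply/setP=> x; rewrite inE; apply/andP/imsetP.
  case=> /forallP xt /eqP x0; exists [tuple x 0 (lift ord0 i) | i < N].
    rewrite inE /in_grid size_tuple eqxx; apply/allP=> c /mapP [i _ ->]; exact: xt.
  apply/rowP=> i; rewrite mxE; case: (unliftP ord0 i) => [j|] -> //.
  transitivity (tnth [tuple x 0 (lift ord0 i) | i < N] j); first by rewrite tnth_mktuple.
  by rewrite (tnth_nth 0).
case=> y; rewrite inE => /andP [_ /allP ynz] ->; split; last by rewrite mxE.
apply/forallP=> i; rewrite mxE; case: (unliftP ord0 i) => [j|] -> /=.
  by apply: ynz; rewrite add0n mem_nth // size_tuple ltn_ord.
exact: oner_neq0.
Qed.

Lemma homogenize_inj : injective (fun x : N.-tuple K => homogenize x).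
Proof.
move=> x y /rowP exy; apply: eq_from_tnth => i; rewrite !(tnth_nth 0).
by have := exy (lift ord0 i); rewrite !mxE.
Qed.

Lemma card_affine_torus : #|affine_torus| = (units_card K ^ N)%N.
Proof. by rewrite affine_torusE card_imset ?card_grid //; exact: homogenize_inj. Qed.

Lemma torus_neq0 x i : x \in affine_torus -> x 0 i != 0.
Proof. by rewrite inE => /andP [/forallP]. Qed.
End AffineTorus.

Section ParamSet.
Variables (K : finFieldType) (N s : nat) (f : 'I_s.+1 -> {set 'I_N.+1}).
Hypothesis unif : is_uniform f.
(** Supplied by normality for [X], and immediate for the clutter of singletons, whose parameterized
    set is the torus. *)
Hypothesis separated : forall (z : 'I_N.+1 -> K) c, (forall k, z k != 0) ->
  (forall i, \prod_(k in f i) z k = c) -> forall a b, z a = z b.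

Local Notation A := (affine_torus K N).
Local Notation X := (param_set K f).
Local Notation cls x := (pclass (param_point f x)).
Local Notation Q := (units_card K).

Definition param_ratio (i : 'I_s.+1) (x : 'rV[K]_N.+1) : K :=
  param_point f x 0 i / param_point f x 0 0.

Lemma param_point_neq0 (x : 'rV[K]_N.+1) i : in_torus x -> param_point f x 0 i != 0.
Proof. by move=> /forallP xt; rewrite mxE; apply/prodf_neq0. Qed.

Lemma param_ratio_neq0 i x : x \in A -> param_ratio i x != 0.
Proof.
by rewrite inE => /andP [xt _]; rewrite mulf_neq0 ?invr_eq0 ?param_point_neq0.
Qed.

Lemma normalized_rep_param x : in_torus x ->
  normalized_rep (cls x) = \row_i param_ratio i x.
Proof.
move=> xt; rewrite normalized_rep_pclass ?param_point_neq0 //.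
by apply/rowP=> i; rewrite !mxE /param_ratio !mxE mulrC.
Qed.

(** The translation is multiplication by [p' / p]; each ratio of monomials, being multiplicative,
    scales by its value there. *)
Lemma homogeneous_param : homogeneous param_ratio A.
Proof.
move=> p p' pA pA'; exists (fun y : 'rV[K]_N.+1 => \row_i (y 0 i * (p' 0 i / p 0 i))).
have nz i : p' 0 i / p 0 i != 0.
  by rewrite mulf_neq0 ?invr_eq0 ?(torus_neq0 i pA) ?(torus_neq0 i pA').
split.
- move=> y y' _ _ /rowP e; apply/rowP=> i; have := e i; rewrite !mxE.
  exact: mulIf.
- by apply/rowP=> i; rewrite mxE mulrC divfK ?(torus_neq0 i pA).
- move=> y yA; rewrite inE; apply/andP; split.
    by apply/forallP=> i; rewrite mxE mulf_neq0 ?(torus_neq0 i yA).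
  move: pA pA' yA; rewrite !inE !mxE => /andP [_ /eqP ->] /andP [_ /eqP ->].
  by case/andP=> _ /eqP ->; rewrite divr1 mul1r.
move=> i; exists (param_ratio i p' / param_ratio i p) => y yA.
have E j : param_point f (\row_i (y 0 i * (p' 0 i / p 0 i))) 0 j =
    param_point f y 0 j * (param_point f p' 0 j / param_point f p 0 j).
  rewrite !mxE -prodf_div -big_split; apply: eq_bigr => k _; by rewrite mxE.
rewrite /param_ratio !E.
have pt x : x \in A -> in_torus x by rewrite inE => /andP [].
have := param_point_neq0 i (pt _ pA); have := param_point_neq0 0 (pt _ pA).
have := param_point_neq0 i (pt _ pA'); have := param_point_neq0 0 (pt _ pA').
have := param_point_neq0 i (pt _ yA); have := param_point_neq0 0 (pt _ yA).
by move=> *; field; do ?[apply/andP; split].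
Qed.

(** Equal ratios mean that all edge monomials agree at [x / y], which is then constant; its first
    coordinate is 1. *)
Lemma param_ratio_separated x y : x \in A -> y \in A ->
  (forall i, param_ratio i x = param_ratio i y) -> x = y.
Proof.
move=> xA yA e.
have h := @separated (fun k => x 0 k / y 0 k) (param_point f x 0 0 / param_point f y 0 0).
have nz k : x 0 k / y 0 k != 0.
  by rewrite mulf_neq0 ?invr_eq0 ?(torus_neq0 k xA) ?(torus_neq0 k yA).
have pt z : z \in A -> in_torus z by rewrite inE => /andP [].
have {}h := h nz _.
apply/rowP=> k; have /h /(_ k 0) : forall i, \prod_(k in f i) (x 0 k / y 0 k) =
    param_point f x 0 0 / param_point f y 0 0.
  move=> i; rewrite prodf_div; have := e i; rewrite /param_ratio.
  rewrite [param_point f x 0 i]mxE [param_point f y 0 i]mxE => /eqP.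
  rewrite eqr_div ?param_point_neq0 ?pt // => /eqP E.
  apply/eqP; rewrite eqr_div ?param_point_neq0 ?pt //; last first.
    by have := param_point_neq0 i (pt _ yA); rewrite mxE.
  by rewrite E mulrC.
have [/eqP -> /eqP ->] : x 0 0 == 1 /\ y 0 0 == 1.
  by move: xA yA; rewrite !inE => /andP [_ ->] /andP [_ ->].
by rewrite divr1 => /divr1_eq.
Qed.

Lemma pclassZ r c (P : 'rV[K]_r) : c != 0 -> pclass (c *: P) = pclass P.
Proof.
move=> c0; apply/setP=> y; apply/imsetP/imsetP => -[b]; rewrite inE => b0 ->.
  by exists (b * c); rewrite ?inE ?mulf_neq0 // scalerA.
by exists (b / c); rewrite ?inE ?mulf_neq0 ?invr_eq0 // scalerA divfK.
Qed.

(** By uniformity, dividing [x] by its first coordinate scales all edge monomials by the same power,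
    so the projective point is unchanged. *)
Lemma param_setE : X = [set cls x | x in A].
Proof.
apply/setP=> p; apply/imsetP/imsetP => -[x]; last first.
  by rewrite inE => /andP [xt _] ->; exists x; rewrite ?inE.
rewrite inE => xt ->; have x0 : x 0 0 != 0 by move/forallP: xt.
exists ((x 0 0)^-1 *: x).
  rewrite inE mxE mulVf // eqxx andbT; apply/forallP=> i.
  by rewrite mxE mulf_neq0 ?invr_eq0 //; move/forallP: xt.
have -> : param_point f ((x 0 0)^-1 *: x) = (x 0 0)^-1 ^+ #|f 0| *: param_point f x.
  apply/rowP=> i; rewrite !mxE (unif 0 i) -prodr_const -big_split.
  by apply: eq_bigr => k _; rewrite mxE.
by rewrite pclassZ // expf_neq0 ?invr_eq0.
Qed.

Lemma param_class_inj : {in A &, injective (fun x => cls x)}.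
Proof.
move=> x y xA yA /(congr1 (@normalized_rep K _)).
have pt z : z \in A -> in_torus z by rewrite inE => /andP [].
rewrite !normalized_rep_param ?pt // => /rowP e.
by apply: param_ratio_separated => // i; have := e i; rewrite !mxE.
Qed.

Lemma card_param_set : #|X| = (Q ^ N)%N.
Proof. by rewrite param_setE card_in_imset ?card_affine_torus //; exact: param_class_inj. Qed.

Lemma param_codeword d p : p \in X ->
  exists2 H : {set 'rV[K]_s.+1} -> K, (\row_j H (enum_val j) <= code_mx X d)%MS &
  H p != 0 /\ let w := #|[set x in X | H x != 0]| in
  w = 1%N \/
  exists es, exists2 r, between Q r & [/\ all (between Q) es,
    (w * \prod_(e <- es) e <= #|X| * r)%N & (d + r <= 1 + \sum_(e <- es) (e - 1))%N].
Proof.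
rewrite {1}param_setE => /imsetP [x0 x0A ->].
(* The greedy product is transported to forms on [X]: the factor [t_i / t_1 - v] becomes the linear
   form [t_i - v t_1], and 1 becomes a power of [t_1]. *)
pose cl e (G : 'rV[K]_N.+1 -> K) := exists2 F : 'rV[K]_s.+1 -> K, is_form e F &
  forall x, x \in A -> G x = F (normalized_rep (cls x)).
have pt z : z \in A -> in_torus z by rewrite inE => /andP [].
have ratio0 x : x \in A -> param_ratio 0 x = 1.
  by move=> xA; rewrite /param_ratio divff // param_point_neq0 ?pt.
have nr x i : x \in A -> normalized_rep (cls x) 0 i = param_ratio i x.
  by move=> xA; rewrite normalized_rep_param ?pt // mxE.
have cl1 e : cl e (fun=> 1).
  elim: e => [|e [F fF hF]]; first by exists (fun=> 1) => //; exact: is_form1.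
  exists (fun P : 'rV[K]_s.+1 => P 0 0 * F P); first exact: is_formX.
  by move=> x xA; rewrite nr // ratio0 // -hF // mulr1.
have clM i e v G : cl e G -> cl e.+1 (fun x => (param_ratio i x - v) * G x).
  case=> F fF hF; exists (fun P : 'rV[K]_s.+1 => P 0 i * F P + (- v) * (P 0 0 * F P)).
    by apply: is_formD; [|apply: is_formZ]; apply: is_formX.
  by move=> x xA; rewrite !nr // ratio0 // -hF //; ring.
have [||y yA hy|G [F fF hF] [Gx0 hw]] :=
  greedy_product cl1 clM (l := enum 'I_s.+1) d x0A.
- by move=> i x; apply: param_ratio_neq0.
- exact: homogeneous_param.
- by apply: param_ratio_separated => // i; apply: hy; rewrite mem_enum.
exists (fun p => F (normalized_rep p)); first exact: is_form_code.
rewrite -hF // Gx0; split=> //.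
have -> : #|[set x in X | F (normalized_rep x) != 0]| = #|[set x in A | G x != 0]|.
  rewrite -(card_in_imset (f := fun x => cls x)
    (D := mem [set x in A | G x != 0])); last first.
    move=> x y; rewrite !inE => /andP [xA _] /andP [yA _].
    by apply: param_class_inj; rewrite inE.
  apply: eq_card => q; rewrite inE param_setE; apply/andP/imsetP.
    case=> /imsetP [x xA ->] h; exists x => //; by rewrite inE xA hF.
  case=> x; rewrite inE => /andP [xA h] ->; rewrite -hF // h; split=> //.
  exact: imset_f.
by rewrite card_param_set -card_affine_torus.
Qed.

Lemma param_hilbE d : hilb X d = \rank (code_mx X d).
Proof.
apply: hilbE => p; case/imsetP=> x; rewrite inE => xt ->.
have [c c0 ->] := rep_pclass (param_point f x).
by rewrite fcoordE mxE mulf_neq0 // param_point_neq0.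
Qed.

(** In these degrees the product inequality forces [w = 1] in the second alternative too, so the
    code contains a multiple of every unit vector. *)
Lemma param_hilb d : (N * (Q - 1) <= d)%N -> hilb X d = #|X|.
Proof.
move=> hd; rewrite param_hilbE; apply/eqP; rewrite -/(row_full _) -sub1mx.
apply/row_subP=> j; rewrite row1.
have [H HC [Hj hw]] := param_codeword d (enum_valP j).
set w := #|_| in hw.
have jw : enum_val j \in [set x in X | H x != 0] by rewrite inE enum_valP.
have w1 : w = 1%N.
  case: hw => // -[es [r br [bes hp hs]]].
  have := prod_ge_of_sum (N := N) br bes.
  rewrite card_param_set in hp.
  have : (0 < Q ^ N * r)%N.
    case/andP: br => r1 rQ; rewrite muln_gt0 r1 andbT expn_gt0.
    by rewrite (leq_trans r1 rQ).
  have : (0 < w)%N by apply/card_gt0P; exists (enum_val j).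
  move: hp; set B := (Q ^ N * r)%N; set Pr := (\prod_(_ <- _) _)%N => hp w0 B0 /(_ _) h.
  have {}h : (B <= Pr)%N by apply: h; lia.
  by nia.
have -> : delta_mx 0 j = (H (enum_val j))^-1 *: \row_j H (enum_val j) :> 'rV[K]_#|X|.
  apply/rowP=> k; rewrite !mxE eqxx /=.
  have [->|kj] := eqVneq k j; first by rewrite mulVf.
  case: (eqVneq (H (enum_val k)) 0) => [->|Hk]; first by rewrite mulr0.
  case/negP: kj; apply/eqP/enum_val_inj.
  have kw : enum_val k \in [set x in X | H x != 0] by rewrite inE enum_valP.
  have /eqP/cards1P [u hu] := w1.
  by move: jw kw; rewrite hu !inE => /eqP -> /eqP ->.
exact: scalemx_sub.
Qed.
End ParamSet.

(** * The projective torus *)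

Section Torus.
Variables (K : finFieldType) (N : nat).
Local Notation T := (proj_torus K N.+1).
Local Notation Q := (units_card K).

Definition singletons (i : 'I_N.+1) : {set 'I_N.+1} := [set i].

Lemma uniform_singletons : is_uniform singletons.
Proof. by move=> i j; rewrite !cards1. Qed.

Lemma separated_singletons (z : 'I_N.+1 -> K) c : (forall k, z k != 0) ->
  (forall i, \prod_(k in singletons i) z k = c) -> forall a b, z a = z b.
Proof. by move=> _ zc a b; move: (zc a) (zc b); rewrite !big_set1 => -> ->. Qed.

Lemma param_point_singletons (x : 'rV[K]_N.+1) : param_point singletons x = x.
Proof. by apply/rowP=> i; rewrite mxE big_set1. Qed.

Lemma proj_torusE : T = param_set K singletons.
Proof. by apply: eq_imset => x; rewrite param_point_singletons. Qed.

(** Dehomogenization: setting the first variable to 1 does not raise the degree. *)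
Lemma polyfun_form d F : is_form d F -> polyfun N d (fun x => F (homogenize N x) : K).
Proof.
case=> c hc.
apply: (@eq_polyfun _ _ _ (fun x => \sum_(a in mons N.+1 d)
   c a * \prod_(i < N) nth 0 x i ^+ (a (inord i.+1) : nat))).
  move=> x sx; rewrite hc; apply: eq_bigr => a _; congr (_ * _).
  rewrite /mon_eval big_ord_recl mxE expr1n mul1r; apply: eq_bigr => i _.
  by rewrite mxE /=; congr (_ ^+ a _); apply: val_inj; rewrite /= inordK ?ltnS.
apply: polyfun_sum => a; rewrite inE big_ord_recl => /eqP ad; apply: polyfunZ.
apply: (@polyfun_monomial K (fun i => a (inord i.+1) : nat)).
rewrite -[leqRHS]ad; apply: leq_trans (leq_addl _ _); apply: eq_leq.
by apply: eq_bigr => i _; congr (nat_of_ord (a _)); apply: val_inj; rewrite /= inordK ?ltnS.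
Qed.

Lemma torus_codeword_weight d v : v != 0 -> (v <= code_mx T d)%MS ->
  exists2 ys : seq nat, all (between Q) ys &
    (N * (Q - 1) <= \sum_(y <- ys) (y - 1) + d)%N /\
    (\prod_(y <- ys) y <= hweight v)%N.
Proof.
move=> v0 /code_is_form [F fF vE].
have TE : T = [set pclass x | x in affine_torus K N].
  rewrite proj_torusE (param_setE K uniform_singletons).
  by apply: eq_imset => x; rewrite param_point_singletons.
have nr (x : N.-tuple K) : normalized_rep (pclass (homogenize N x)) = homogenize N x.
  by rewrite normalized_rep_pclass !mxE ?oner_neq0 // invr1 scale1r.
have gridP p : p \in T ->
    exists2 x : N.-tuple K, in_grid N x & p = pclass (homogenize N x).
  rewrite TE affine_torusE => /imsetP [_ /imsetP [x + ->] ->].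
  by rewrite inE => gx; exists x.
have [|ys bys [hs hp]] := alon_furedi (polyfun_form fF).
  have [j] : exists j, v 0 j != 0.
    apply/existsP; apply: contraNT v0; rewrite negb_exists => /forallP h.
    by apply/eqP/rowP=> j; rewrite mxE; apply/eqP; have := h j; rewrite negbK.
  rewrite vE mxE; have [x gx ->] := gridP _ (enum_valP j).
  by rewrite nr => ?; exists (x : seq K).
exists ys => //; split=> //; apply: leq_trans hp _.
rewrite vE (hweight_row T (fun p => F (normalized_rep p))) grid_weightE.
have inj : injective (fun x : N.-tuple K => pclass (homogenize N x)).
  by move=> x y /(congr1 (@normalized_rep K _)); rewrite !nr => /homogenize_inj.
rewrite -(card_imset _ inj); apply/subset_leq_card/subsetP.
move=> _ /imsetP [x + ->]; rewrite !inE => /andP [gx Fx]; rewrite nr Fx andbT TE.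
by apply: imset_f; rewrite affine_torusE imset_f // inE.
Qed.

Lemma torus_hilb d : (N * (Q - 1) <= d)%N -> hilb T d = #|T|.
Proof.
rewrite proj_torusE; apply: param_hilb; first exact: uniform_singletons.
exact: separated_singletons.
Qed.

Lemma card_proj_torus : #|T| = (Q ^ N)%N.
Proof.
rewrite proj_torusE; apply: card_param_set; first exact: uniform_singletons.
exact: separated_singletons.
Qed.

(** A full code would contain a unit vector. Its weight 1 forces every entry of [ys] to be 1,
    against the positive lower bound on the decrements. *)
Lemma torus_hilb_lt d : (d < N * (Q - 1))%N -> hilb T d <> #|T|.
Proof.
move=> hd; rewrite {1}proj_torusE param_hilbE -proj_torusE => /eqP full.
have T0 : (0 < #|T|)%N.
  rewrite card_proj_torus expn_gt0; case: (Q) hd => [|//]; rewrite muln0 //.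
pose j := Ordinal T0.
have [||ys bys [hs hp]] := @torus_codeword_weight d (delta_mx 0 j).
- by apply/eqP=> /rowP /(_ j); rewrite !mxE !eqxx => /eqP; rewrite oner_eq0.
- by apply: submx_full.
have w1 : hweight (delta_mx 0 j : 'rV[K]_#|T|) = 1%N.
  rewrite /hweight (_ : [set _ | _] = [set j]) ?cards1 //; apply/setP=> k.
  by rewrite !inE mxE eqxx /=; case: (k == j); rewrite ?oner_neq0 ?eqxx.
have : (1 <= N * (Q - 1) - d)%N by lia.
(* The product inequality is used with [N = 0] and [r = 2]; the bound on [d] excludes [Q <= 1]. *)
have Q2 : between Q 2.
  by rewrite /between; case: (Q) hd => [|[|]] //; rewrite muln0.
have := prod_ge_of_sum (N := 0) Q2 bys.
rewrite w1 in hp; rewrite mul0n expn0 mul1n => h _.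
have : (2 <= \prod_(y <- ys) y)%N by apply: h; lia.
by rewrite leqNgt ltnS hp.
Qed.

Lemma torus_is_reg : is_reg T (N * (Q - 1)).
Proof.
split=> [d|p h]; first exact: torus_hilb.
rewrite leqNgt; apply/negP=> hp; set e := (N * (Q - 1))%N in hp *.
apply: (@torus_hilb_lt e.-1); first by rewrite -/e prednK //; lia.
by apply: h; lia.
Qed.
End Torus.

(** * Existence of the regularity and the three conclusions *)

Lemma is_reg_exists (K : finFieldType) r (Y : {set {set 'rV[K]_r}}) D :
  (forall d, (D <= d)%N -> hilb Y d = #|Y|) ->
  exists2 p, is_reg Y p & (p <= D)%N.
Proof.
move=> hD.
(* Only the finitely many degrees below [D] need testing, so the condition is decidable and has a
   least solution. *)
pose P p := [forall d : 'I_D, (p <= d)%N ==> (hilb Y d == #|Y|)].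
have PD : P D by apply/forallP=> d; rewrite leqNgt ltn_ord.
have exP : exists p, P p by exists D.
case: (ex_minnP exP) => p /forallP Pp pmin; exists p; last exact: pmin.
split=> [d pd|p' h].
  case: (ltnP d D) => [dD|]; last exact: hD.
  by have := Pp (Ordinal dD); rewrite /= pd => /eqP.
by apply: pmin; apply/forallP=> d; apply/implyP=> /h ->.
Qed.

Theorem theorem5p1 (K : finFieldType) (n s : nat) (f : 'I_s -> {set 'I_n}) :
  #|K| != 2%N ->
  (2 <= s)%N ->
  is_clutter f ->
  is_uniform f ->
  \rank (incidence_mx f) = n ->
  edge_ideal_normal f ->
  let q := #|K| in
  let X := param_set K f in
  let T := proj_torus K n in
  (* (a) *)
  (is_degree X ((q - 1) ^ (n - 1))%N /\ #|X| = ((q - 1) ^ (n - 1))%N) /\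
  (* (b) *)
  (forall d : nat, (1 <= d)%N -> (min_dist X d <= min_dist T d)%N) /\
  (* (c) *)
  (exists regX regT : nat,
     is_reg X regX /\ is_reg T regT /\ (regX <= regT)%N /\
     regT = ((q - 2) * (n - 1))%N).
Proof.
case: s f => [//|[//|s]] f _ _ clu unif rk nrm.
(* By uniformity one empty edge would make edge 0 empty, hence contained in edge 1, which a clutter
   forbids. *)
have fne i : (0 < #|f i|)%N.
  rewrite (unif i 0) lt0n cards_eq0; apply/eqP=> f0.
  by have := clu 0 1 isT; rewrite f0 sub0set.
have n0 : (0 < n)%N.
  by case: n f {clu unif rk nrm} fne => // f /(_ 0); rewrite cardE; case: (enum _) => [|[]].
case: n n0 f clu unif rk nrm fne => [//|N] _ f clu unif rk nrm fne.
have sep (z : 'I_N.+1 -> K) c := @constant_of_normal _ _ f unif fne rk isT nrm K z c.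
pose Q := units_card K.
have QE : #|K| = Q.+1.
  rewrite (cardD1 (0 : K)) inE /= add1n; congr S.
  by apply: eq_card => c; rewrite !inE andbT.
move=> q X T.
have -> : (q - 1 = Q)%N by rewrite /q QE subn1.
have -> : ((q - 2) * (N.+1 - 1) = N * (Q - 1))%N by rewrite /q QE !subSS subn0 mulnC.
rewrite subn1 /=.
have cX : #|X| = (Q ^ N)%N by apply: card_param_set.
have hX d : (N * (Q - 1) <= d)%N -> hilb X d = #|X| by apply: param_hilb.
split; [split=> //; exists (N * (Q - 1))%N => d /hX ->; exact: cX|split].
  move=> d _; rewrite [min_dist T d]/min_dist.
  (* The default value of the minimum for the torus is covered because both sets have [Q ^ N]
     points. *)
  apply: (big_ind (fun m => min_dist X d <= m)%N).
  - by rewrite card_proj_torus -[leqRHS]cX min_dist_le_card.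
  - by move=> x y hx hy; rewrite leq_min hx hy.
  move=> v /andP [v0 /(torus_codeword_weight v0) [ys bys [hs hp]]].
  apply: leq_trans hp.
  have /card_gt0P [p pX] : (0 < #|X|)%N.
    rewrite cX expn_gt0 /Q; apply/orP; left; apply/card_gt0P.
    by exists 1; rewrite inE oner_neq0.
  have [H HC [Hp hw]] := param_codeword unif sep d pX.
  apply: leq_trans (min_dist_le _ HC) _.
    apply/eqP=> /rowP /(_ (enum_rank_in pX p)); rewrite !mxE enum_rankK_in //.
    by move/eqP; rewrite (negPf Hp).
  rewrite (hweight_row X H); move: hw; set w := #|_|; case=> [->|].
    rewrite big_seq_cond; apply: prodn_cond_gt0 => i; rewrite andbT => hi.
    by have /allP /(_ i hi) /andP [] := bys.
  case=> es [r br [bes hpe hse]].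
  (* Adding the two sum bounds cancels [d]. The joint product is then at least [Q ^ N * r], hence at
     least [w] times the product of [es], which is cancelled. *)
  have := prod_ge_of_sum (N := N) (es := ys ++ es) br.
  rewrite all_cat bys bes !big_cat /= => /(_ isT) h.
  have {}h := h ltac:(lia).
  have e0 : (0 < \prod_(e <- es) e)%N.
    rewrite big_seq_cond; apply: prodn_cond_gt0 => i; rewrite andbT => hi.
    by have /allP /(_ i hi) /andP [] := bes.
  rewrite -(leq_pmul2r e0); apply: leq_trans hpe _.
  by rewrite -[#|_|]/(#|X|) cX.
have [p regp pD] := is_reg_exists hX.
exists p; exists (N * (Q - 1))%N; split=> //; split; first exact: torus_is_reg.
by split.
Qed.
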